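(* Let $n\geq 2$ and let $K_n$ be the complete graph on $n$ vertices. For a graph $P$: (1) if $\mathrm{diam}(P)\geq 4$ and $r(P)\geq 3$, then $A_{ucg}(K_n,P)=2$; (2) if $\mathrm{diam}(P)\geq 3$ and $r(P)=2$, then $A_{ucg}(K_n,P)=3$. Furthermore, for every $t\in\mathbb{N}$ there is a graph $P$ with $\mathrm{diam}(P)=r(P)=2$ and $A_{ucg}(K_n,P)\geq t$.
   Context: All graphs are finite and simple. $d(u,v)$ denotes distance ($\infty$ if no path). Eccentricity $e(v)=\max_u d(u,v)$; radius $r(G)$ = minimum eccentricity, diameter $\mathrm{diam}(G)$ = maximum eccentricity. For a graph $H$: the center $Z(H)$ is the set of vertices of minimum eccentricity; $EC(v)=\{x: d(v,x)=e(v)\}$; the centered periphery is $CP(H)=\bigcup_{z\in Z(H)} EC(z)$; $\langle S\rangle$ is the induced subgraph on $S$. $H$ is a uniform central graph (UCG) if $EC(c)$ is the same for all $c\in Z(H)$. $I(H)=V(H)\setminus(Z(H)\cup CP(H))$. For graphs $C,P$, $A_{ucg}(C,P)$ is the minimum of $|I(H)|$ over all UCGs $H$ with $\langle Z(H)\rangle\cong C$ and $\langle CP(H)\rangle\cong P$, and $\infty$ if no such $H$ exists. *)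

(* Defs.v *)
From HB Require Import structures.
From mathcomp Require Import all_boot all_order.
From mathcomp Require Import boolp.

Set Implicit Arguments.
Unset Strict Implicit.
Unset Printing Implicit Defensive.

Import Order.TTheory.

(* Extended naturals: [Fin n] is the natural number n, [Inf] is infinity.     *)
Definition enat : Type := option nat.
Definition Fin (n : nat) : enat := Some n.
Definition Inf : enat := None.

HB.instance Definition _ := Choice.on enat.

Definition enat_le (x y : enat) : bool :=
  match x, y with
  | _, None => true
  | None, Some _ => false
  | Some m, Some n => m <= n
  end.
Definition enat_lt (x y : enat) : bool := (y != x) && enat_le x y.
Definition enat_min (x y : enat) : enat := if enat_lt x y then x else y.
Definition enat_max (x y : enat) : enat := if enat_lt x y then y else x.

Fact enat_le_anti : antisymmetric enat_le.
Proof. by move=> [m|] [n|] //= /anti_leq ->. Qed.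

Fact enat_le_trans : transitive enat_le.
Proof. by move=> [n|] [m|] [p|] //=; apply: leq_trans. Qed.

Fact enat_le_total : total enat_le.
Proof. by move=> [m|] [n|] //=; apply: leq_total. Qed.

Fact enat_display : Order.disp_t. Proof. exact. Qed.

HB.instance Definition _ :=
  Order.isOrder.Build enat_display enat
    (fun _ _ => erefl) (fun _ _ => erefl) (fun _ _ => erefl)
    enat_le_anti enat_le_trans enat_le_total.

Fact enat_le0x (x : enat) : enat_le (Fin 0) x.
Proof. by case: x. Qed.

Fact enat_lex1 (x : enat) : enat_le x Inf.
Proof. by case: x. Qed.

HB.instance Definition _ :=
  Order.hasBottom.Build enat_display enat enat_le0x.
HB.instance Definition _ := Order.hasTop.Build enat_display enat enat_lex1.

Record sgraph := SGraph {
  vertex :> finType;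
  adj : rel vertex;
  adj_sym : symmetric adj;
  adj_irr : irreflexive adj }.

Definition graph_iso (G H : sgraph) : Prop :=
  exists f : G -> H, bijective f /\ forall x y, adj (f x) (f y) = adj x y.

Section Induced.
Variables (G : sgraph) (S : {set G}).

Definition induced_adj : rel {x : G | x \in S} :=
  fun x y => adj (val x) (val y).

Fact induced_sym : symmetric induced_adj.
Proof. by move=> x y; apply: adj_sym. Qed.

Fact induced_irr : irreflexive induced_adj.
Proof. by move=> x; apply: adj_irr. Qed.

Definition induced : sgraph := SGraph induced_sym induced_irr.
End Induced.

Section Complete.
Variable n : nat.

Definition complete_adj : rel 'I_n := fun i j => i != j.

Fact complete_sym : symmetric complete_adj.
Proof. by move=> i j; rewrite /complete_adj eq_sym. Qed.

Fact complete_irr : irreflexive complete_adj.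
Proof. by move=> i; rewrite /complete_adj eqxx. Qed.

Definition complete : sgraph := SGraph complete_sym complete_irr.
End Complete.

Section Metric.
Variable G : sgraph.

Definition walk (k : nat) (u v : G) : bool :=
  [exists p : k.-tuple G, path (@adj G) u p && (last u p == v)].

(* A shortest walk repeats no vertex, so its length is below #|G|; the minimum *)
(* over the empty set is [Inf].                                                *)
Definition dist (u v : G) : enat :=
  \big[Order.min/Inf]_(k < #|G| | walk k u v) Fin k.

Definition ecc (v : G) : enat := \big[Order.max/Fin 0]_(u : G) dist u v.

Definition radius : enat := \big[Order.min/Inf]_(v : G) ecc v.

Definition diam : enat := \big[Order.max/Fin 0]_(v : G) ecc v.

Definition center : {set G} := [set v | ecc v == radius].

Definition EC (v : G) : {set G} := [set x | dist v x == ecc v].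

Definition CP : {set G} := \bigcup_(z in center) EC z.

Definition is_UCG : Prop := {in center &, forall c c', EC c = EC c'}.

Definition inter : {set G} := ~: (center :|: CP).
End Metric.

Section Aucg.
Variables C P : sgraph.

Definition ucg_realizable (k : nat) : Prop :=
  exists H : sgraph,
    [/\ is_UCG H, graph_iso (induced (center H)) C,
        graph_iso (induced (CP H)) P & #|inter H| = k].

Definition A_ucg : enat :=
  if pselect (exists k, `[< ucg_realizable k >]) is left ex
  then Fin (ex_minn ex) else Inf.
End Aucg.

(* Main.v *)
(** Lower bounds.  Let [H] be a UCG of radius [r] with center [K_n], [n >= 2],
    and let [c] be central.  Since all central vertices have the same
    eccentric vertices, [r >= 2] and every vertex outside [CP H] is at distance
    less than [r] from [c].  Hence each non-central neighbour [a] of [c]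
    has a vertex [p_a] of [P] at distance at least [r + 1], while each vertex
    of [P] is at distance [r - 1] from some such [a].  So the [p_a], of which
    there are at most [#|inter H|], have no common closed neighbour in [P].
    This forces two of them in general, three if some [w] in [P] has
    eccentricity at most 2 (one may take [w] among the [p_a]), and all the
    vertices if [P] is a cocktail party graph.

    Upper bounds.  Join [K_n] to an independent set [J] and attach each vertex
    [p] of [P] to one [f p] in [J].  With [J] of size 3, [f] separates the
    closed neighbourhood of an endpoint of a diameter from the rest and leaves
    one element of [J] unused.  With [J] of size 2, [f] is a 2-colouring
    giving each vertex a vertex at distance at least 3 of the other colour and
    constant on the closed neighbourhoods of both endpoints of a diameter. *)

Require Import Defs.
From mathcomp Require Import all_boot all_order.
From mathcomp Require Import boolp.

Set Implicit Arguments.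
Unset Strict Implicit.
Unset Printing Implicit Defensive.

Import Order.TTheory.

(** * Distance, radius and center through walks of bounded length *)

Lemma Fin_ltE (k : nat) (x : enat) : (Fin k < x)%O = (Fin k.+1 <= x)%O.
Proof.
by case: x => [m|] //; rewrite lt_neqAle; exact: (esym (ltn_neqAle k m)).
Qed.

Section Within.
Variable G : sgraph.
Implicit Types u v w : G.

(** A recursive form of [dist u v <= Fin k]: the triangle inequality becomes addition of indices,
    with no arithmetic in [enat]. The test [u == v] at every level makes [k] a bound on the length
    instead of the exact length. *)
Fixpoint within (k : nat) u v : bool :=
  (u == v) ||
  if k is k'.+1 then [exists w, adj u w && within k' w v] else false.

Lemma within0 u v : within 0 u v = (u == v).
Proof. by rewrite /= orbF. Qed.

Lemma withinS k u v :
  within k.+1 u v = (u == v) || [exists w, adj u w && within k w v].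
Proof. by []. Qed.

Lemma within_refl k u : within k u u.
Proof. by case: k => [|k] /=; rewrite eqxx. Qed.

Lemma within_cons k u w v : adj u w -> within k w v -> within k.+1 u v.
Proof.
by move=> uw wv; rewrite withinS; apply/orP; right; apply/existsP; exists w;
   rewrite uw.
Qed.

Lemma within_adj u v : adj u v -> within 1 u v.
Proof. by move=> /within_cons; apply; apply: within_refl. Qed.

Lemma within_leq j k u v : j <= k -> within j u v -> within k u v.
Proof.
elim: k j u => [|k IH] [|j] u //; rewrite ?ltnS => jk.
  by rewrite within0 => /eqP ->; apply: within_refl.
rewrite withinS => /orP [/eqP ->|/existsP [w /andP [uw wv]]].
  exact: within_refl.
exact: within_cons uw (IH _ _ jk wv).
Qed.

Lemma within_trans j k u v w :
  within j u v -> within k v w -> within (j + k) u w.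
Proof.
elim: j u => [|j IH] u; first by rewrite within0 => /eqP ->.
rewrite withinS => /orP [/eqP -> vw|/existsP [x /andP [ux xv]] vw].
  exact: within_leq (leq_addl _ _) vw.
exact: within_cons ux (IH _ xv vw).
Qed.

Lemma within_sym k u v : within k u v = within k v u.
Proof.
suff imp u' v' : within k u' v' -> within k v' u' by apply/idP/idP; apply: imp.
elim: k u' v' => [|k IH] u' v'; first by rewrite !within0 eq_sym.
rewrite withinS => /orP [/eqP ->|/existsP [w /andP [uw /IH vw]]].
  exact: within_refl.
by rewrite -addn1; apply: within_trans vw _; apply: within_adj; rewrite adj_sym.
Qed.

Lemma within1E u v : within 1 u v = (u == v) || adj u v.
Proof.
rewrite withinS; congr (_ || _); apply/existsP/idP => [[w /andP [uw]]|uv].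
  by rewrite within0 => /eqP <-.
by exists v; rewrite uv within_refl.
Qed.

Lemma within2P u v : within 2 u v ->
  [\/ u = v, adj u v | exists2 w, adj u w & adj w v].
Proof.
rewrite withinS => /orP [/eqP ->|/existsP [w /andP [uw]]]; first by constructor.
rewrite within1E => /orP [/eqP <-|wv]; first by constructor 2.
by constructor 3; exists w.
Qed.

Lemma within2_midpoint u v : within 2 u v -> exists2 w, within 1 u w & within 1 w v.
Proof.
rewrite withinS => /orP [/eqP ->|/existsP [w /andP [uw wv]]].
  by exists v; apply: within_refl.
by exists w => //; apply: within_adj.
Qed.

Lemma within_pathP k u v : reflect
  (exists p, [/\ path (@adj G) u p, last u p = v & size p <= k]) (within k u v).
Proof.
elim: k u => [|k IH] u.
  rewrite within0; apply: (iffP eqP) => [->|[p [_ <-]]]; first by exists [::].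
  by case: p.
rewrite withinS; apply: (iffP orP) => [[/eqP ->|/existsP [w /andP [uw]]]|].
- by exists [::].
- by move=> /IH [p [up lp sp]]; exists (w :: p); rewrite /= uw.
case=> [[|w p]] [/= up lp sp]; first by left; apply/eqP.
case/andP: up => uw wp; right; apply/existsP; exists w; rewrite uw /=.
by apply/IH; exists p.
Qed.

Lemma dist_leE k u v : (dist u v <= Fin k)%O = within k u v.
Proof.
apply/idP/within_pathP => [|[p [up lp sp]]].
  rewrite leNgt => /negP nlt.
  case: (pickP (fun j : 'I_#|G| => walk j u v && (j <= k))) => [j|none].
    case/andP=> /existsP [p /andP [up /eqP lp]] jk.
    by exists p; rewrite size_tuple.
  case: nlt; apply/bigmin_gtP; split=> // j juv.
  have := none j; rewrite juv /= => /negbT; rewrite -ltnNge Fin_ltE.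
  exact.
(* [dist] minimises only over lengths below [#|G|], so the path is first shortened to one without
   repeated vertices. *)
have [q [uq lq sq q_lt]] : exists q,
    [/\ path (@adj G) u q, last u q = v, size q <= k & size q < #|G|].
  case/shortenP: up lp => q uq q_uniq sub_qp lq.
  exists q; split=> //.
    exact: leq_trans (uniq_leq_size (andP q_uniq).2 sub_qp) sp.
  by rewrite -[_.+1]/(size (u :: q)) -(card_uniqP q_uniq) max_card.
have q_walk : walk (size q) u v.
  by apply/existsP; exists (in_tuple q); rewrite /= uq lq eqxx.
by apply: (bigmin_inf (Ordinal q_lt)).
Qed.

Lemma ecc_leP k v : reflect (forall u, within k u v) (ecc v <= Fin k)%O.
Proof.
apply: (iffP (bigmax_leP _ _ _ _)) => [[_ h] u|h].
  by rewrite -dist_leE; apply: h.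
by split=> // u _; rewrite dist_leE.
Qed.

Lemma ecc_gtP k v : reflect (exists u, ~~ within k u v) (Fin k < ecc v)%O.
Proof.
rewrite ltNge; apply: (iffP negP) => [h|[u nuv] /ecc_leP /(_ u)]; last first.
  exact/negP.
by apply/existsP; rewrite -negb_forall; apply/negP => /forallP /ecc_leP.
Qed.

Lemma radius_le_ecc v : (radius G <= ecc v)%O.
Proof. exact: bigmin_le. Qed.

Lemma radius_leP k : reflect (exists v, forall u, within k u v)
  (radius G <= Fin k)%O.
Proof.
apply: (iffP idP) => [|[v /ecc_leP]]; last exact: le_trans (radius_le_ecc v).
rewrite leNgt => /negP nlt.
case: (pickP (fun v => (ecc v <= Fin k)%O)) => [v /ecc_leP|none].
  by exists v.
by case: nlt; apply/bigmin_gtP; split=> // v _; rewrite ltNge none.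
Qed.

Lemma diam_leP k : reflect (forall u v, within k u v) (diam G <= Fin k)%O.
Proof.
apply: (iffP (bigmax_leP _ _ _ _)) => [[_ h] u v|h].
  by apply/ecc_leP; apply: h.
by split=> // v _; apply/ecc_leP.
Qed.

Lemma diam_gtP k : (Fin k < diam G)%O -> exists u v, ~~ within k u v.
Proof.
rewrite ltNge => /negP h.
case: (pickP (fun x : G * G => ~~ within k x.1 x.2)) => [[u v]|none].
  by exists u, v.
case: h; apply/diam_leP => u v; have := none (u, v) => /= /negbT.
by rewrite negbK.
Qed.

Lemma radius_gt_ecc k v : (Fin k < radius G)%O -> exists u, ~~ within k u v.
Proof. by move=> h; apply/ecc_gtP; apply: lt_le_trans h (radius_le_ecc v). Qed.

Lemma radius_eqP k :
  (exists v, forall u, within k.+1 u v) -> (forall v, exists u, ~~ within k u v) ->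
  radius G = Fin k.+1.
Proof.
move=> le_k gt_k; apply/eqP; rewrite eq_le; apply/andP; split.
  exact/radius_leP.
rewrite -Fin_ltE ltNge; apply/negP => /radius_leP [v hv].
by have [u /negP] := gt_k v.
Qed.

Section FiniteRadius.
Variable s : nat.
Hypothesis radiusE : radius G = Fin s.+1.

Lemma centerP c : reflect (forall u, within s.+1 u c) (c \in center G).
Proof.
rewrite inE; apply: (iffP eqP) => [ec|/ecc_leP h].
  by apply/ecc_leP; rewrite ec radiusE.
by apply/eqP; rewrite eq_le radius_le_ecc andbT radiusE.
Qed.

Lemma centerPn c : reflect (exists u, ~~ within s.+1 u c) (c \notin center G).
Proof.
apply: (iffP negP) => [nc|[u h] /centerP /(_ u)]; last exact/negP.
by apply/existsP; rewrite -negb_forall; apply/negP => /forallP /centerP.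
Qed.

(** Everything is within the radius [s.+1] of [c], so being at distance exactly [s.+1] amounts to
    not being within [s]. *)
Lemma in_EC c x : c \in center G -> (x \in EC c) = ~~ within s c x.
Proof.
move=> cc; rewrite inE.
have -> : ecc c = Fin s.+1 by move: cc; rewrite inE radiusE => /eqP.
rewrite eq_le dist_leE within_sym (centerP _ cc) /= -Fin_ltE ltNge dist_leE.
by [].
Qed.

Lemma in_CP c x : is_UCG G -> c \in center G -> (x \in CP G) = ~~ within s c x.
Proof.
move=> ucg cc; rewrite -in_EC //; apply/bigcupP/idP => [[z zc]|xc].
  by rewrite (ucg c z).
by exists c.
Qed.

End FiniteRadius.
End Within.

(** * Induced subgraphs as images of embeddings *)

Lemma within_embed (G H : sgraph) (e : G -> H) k (u v : G) :
  (forall x y, adj (e x) (e y) = adj x y) ->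
  within k u v -> within k (e u) (e v).
Proof.
move=> e_adj; elim: k u => [|k IH] u; first by rewrite !within0 => /eqP ->.
rewrite withinS => /orP [/eqP ->|/existsP [w /andP [uw wv]]].
  exact: within_refl.
by apply: within_cons (IH _ wv); rewrite e_adj.
Qed.

(** Trades the subtype of [S] for an embedding, so that distances are measured between vertices of
    [H] itself. *)
Lemma induced_isoP (G H : sgraph) (S : {set H}) :
  graph_iso (induced S) G <->
  exists e : G -> H, [/\ injective e,
    forall x y, adj (e x) (e y) = adj x y & S = [set e x | x : G]].
Proof.
split=> [[f [[g fK gK] f_adj]]|[e [e_inj e_adj defS]]].
  exists (fun x => val (g x)); split.
  - by move=> x y /val_inj /(can_inj gK).
  - by move=> x y; rewrite -{2}[x]gK -{2}[y]gK f_adj.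
  - apply/setP => y; apply/idP/imsetP => [yS|[x _ ->]]; last exact: valP (g x).
    by exists (f (exist _ y yS)); rewrite ?fK.
have eS x : e x \in S by rewrite defS imset_f.
have eV (y : induced S) : exists x, e x == val y.
  by case: y => /= y; rewrite {1}defS => /imsetP [x _ ->]; exists x.
exists (fun y => xchoose (eV y)); split=> [|x y].
  exists (fun x => exist _ (e x) (eS x)).
    by move=> y; apply: val_inj; apply/eqP; apply: xchooseP (eV y).
  by move=> x; apply: e_inj; apply/eqP; apply: xchooseP (eV _).
by rewrite -e_adj !(eqP (xchooseP (eV _))).
Qed.

(** * Bounding the minimum [A_ucg] *)

Section AucgBounds.
Variables C P : sgraph.

Lemma A_ucg_eq k : ucg_realizable C P k ->
  (forall j, ucg_realizable C P j -> k <= j) -> A_ucg C P = Fin k.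
Proof.
move=> rk min_k; rewrite /A_ucg; case: pselect => [ex|[]]; last first.
  by exists k; apply/asboolP.
congr Some; case: ex_minnP => m /asboolP rm min_m; apply/eqP.
by rewrite eqn_leq min_k // min_m //; apply/asboolP.
Qed.

Lemma A_ucg_ge k : (forall j, ucg_realizable C P j -> k <= j) ->
  (Fin k <= A_ucg C P)%O.
Proof.
move=> min_k; rewrite /A_ucg; case: pselect => // ex.
by case: ex_minnP => m /asboolP /min_k.
Qed.

End AucgBounds.

(** Equivalently, [S] is a total dominating set of the complement of [P]. *)
Definition no_common_closed_nbr (P : sgraph) (S : {set P}) : Prop :=
  forall q, exists2 s, s \in S & ~~ within 1 s q.

(** * Lower bound: far vertices of the outer neighbours of a central vertex *)

Section LowerBound.
Variables (n : nat) (P H : sgraph) (eZ : 'I_n -> H) (eP : P -> H).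
Hypothesis n_ge2 : 2 <= n.
Hypothesis ucg : is_UCG H.
Hypothesis eZ_adj : forall i j, adj (eZ i) (eZ j) = (i != j).
Hypothesis centerE : center H = [set eZ i | i : 'I_n].
Hypothesis eP_adj : forall x y, adj (eP x) (eP y) = adj x y.
Hypothesis CPE : CP H = [set eP x | x : P].

Let c0 := eZ (Ordinal (ltnW n_ge2)).
Let c1 := eZ (Ordinal n_ge2).

Let c0_center : c0 \in center H.
Proof. by rewrite centerE imset_f. Qed.

Let c1_center : c1 \in center H.
Proof. by rewrite centerE imset_f. Qed.

Let eP_CP p : eP p \in CP H.
Proof. by rewrite CPE imset_f. Qed.

(** Infinite radius would make every vertex central and [H] complete, of radius at most 1. Radius 0
    would identify [c0] and [c1]. Radius 1 would put [c1] in [EC c0], hence by uniformity in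
    [EC c1]. *)
Lemma ucg_radius_ge2 : exists s, radius H = Fin s.+2.
Proof.
have c01 : adj c0 c1 by rewrite eZ_adj.
have c0N1 : c1 != c0 by apply: contraTneq c01 => ->; rewrite adj_irr.
case rad: (radius H) => [[|[|s]]|]; last 1 first.
- have : (radius H <= Fin 1)%O; last by rewrite rad.
  apply/radius_leP; exists c0 => u.
  have : u \in center H.
    by rewrite inE eq_le radius_le_ecc andbT rad; case: (ecc u).
  rewrite centerE => /imsetP [i _ ->]; rewrite within1E eZ_adj -implyNb.
  by apply/implyP; apply: contraNneq => ->; rewrite eqxx.
- have /radius_leP [v hv] : (radius H <= Fin 0)%O by rewrite rad.
  by move: (hv c0) (hv c1) c0N1; rewrite !within0 => /eqP -> /eqP ->;
     rewrite eqxx.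
- have : c1 \in EC c0 by rewrite (in_EC rad) // within0 eq_sym.
  by rewrite (ucg c0_center c1_center) (in_EC rad) // within_refl.
- by exists s.
Qed.

Section FixRadius.
Variable s : nat.
Hypothesis rad : radius H = Fin s.+2.

Let outer_nbrs : {set H} := [set a | adj c0 a & a \notin center H].

Lemma outer_nbrs_sub_inter : outer_nbrs \subset inter H.
Proof.
apply/subsetP => a; rewrite inE => /andP [c0a naC].
rewrite in_setC in_setU negb_or naC /=.
rewrite (in_CP rad _ ucg c0_center) negbK.
exact: within_leq (within_adj c0a).
Qed.

(** Some [v] is beyond [s.+2] from the non-central [a]. It lies in [CP H]: within [s.+1] of [c0], it
    would be within [s.+2] of [a] through [c0]. *)
Lemma outer_nbr_far a : a \in outer_nbrs -> exists p, ~~ within s.+2 (eP p) a.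
Proof.
rewrite inE => /andP [c0a /(centerPn rad) [v nva]].
have : v \in CP H.
  rewrite (in_CP rad _ ucg c0_center); apply: contra nva => c0v.
  by rewrite within_sym; apply: within_cons c0v; rewrite adj_sym.
by rewrite CPE => /imsetP [p _ defv]; exists p; rewrite -defv.
Qed.

(** Take the first step of a shortest walk from [c0] to [eP q]. It is not central, since by
    uniformity no central vertex is within [s.+1] of [eP q]. *)
Lemma outer_nbr_near q : exists2 a, a \in outer_nbrs & within s.+1 a (eP q).
Proof.
have nq z : z \in center H -> ~~ within s.+1 z (eP q).
  by move=> zC; rewrite -(in_CP rad _ ucg zC).
have := centerP rad _ c0_center (eP q).
rewrite within_sym withinS => /orP [/eqP c0q|/existsP [a /andP [c0a aq]]].
  by have := nq _ c0_center; rewrite c0q within_refl.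
exists a => //; rewrite inE c0a /=.
by apply: contraL aq; apply: nq.
Qed.

(** If [a] is within [s.+1] of [q], then [far a] in the closed neighbourhood of [q] would be within
    [s.+2] of [a]. *)
Lemma far_choice_no_common (far : H -> P) :
  {in outer_nbrs, forall a, ~~ within s.+2 (eP (far a)) a} ->
  no_common_closed_nbr [set far a | a in outer_nbrs].
Proof.
move=> farP q; have [a aN aq] := outer_nbr_near q.
exists (far a); first exact: imset_f.
apply: contra (farP a aN) => /(within_embed eP_adj) pq.
by apply: (within_trans pq); rewrite within_sym.
Qed.

(** Supplies the default value that makes [default_far] total. *)
Lemma CP_inhabited : P.
Proof.
case: (pickP (@predT P)) => [//|noP]; exfalso.
have [v] : exists v, ~~ within s.+1 v c0.
  by apply: radius_gt_ecc; rewrite rad Fin_ltE lexx.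
rewrite within_sym -(in_CP rad _ ucg c0_center) CPE => /imsetP [p].
by have := noP p.
Qed.

Let default_far (a : H) : P :=
  odflt CP_inhabited [pick p | ~~ within s.+2 (eP p) a].

Let default_farP : {in outer_nbrs, forall a, ~~ within s.+2 (eP (default_far a)) a}.
Proof.
move=> a /outer_nbr_far [p hp]; rewrite /default_far.
by case: pickP => // /(_ p); rewrite hp.
Qed.

Lemma far_set_le_inter (far : H -> P) :
  #|[set far a | a in outer_nbrs]| <= #|inter H|.
Proof.
apply: leq_trans (leq_imset_card _ _) _.
exact: subset_leq_card outer_nbrs_sub_inter.
Qed.

Lemma far_set_exists :
  exists2 S : {set P}, no_common_closed_nbr S & #|S| <= #|inter H|.
Proof.
exists [set default_far a | a in outer_nbrs].
  exact: far_choice_no_common default_farP.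
exact: far_set_le_inter.
Qed.

(* A vertex [w] of eccentricity at most 2 in [P] can only be far from a vertex
   of [inter H]; if the latter neighbours [c0], [w] may serve as its far vertex. *)
Lemma far_set_exists_through w : (forall u, within 2 u w) ->
  exists S : {set P}, [/\ no_common_closed_nbr S, #|S| <= #|inter H|
                        & w \in S \/ #|S| < #|inter H|].
Proof.
move=> w2.
have nwC : eP w \notin center H.
  apply/negP => /(in_CP rad (eP w) ucg).
  by rewrite eP_CP within_refl.
have [v nvw] := centerPn rad _ nwC.
have vI : v \in inter H.
  (* A central [v] would be within the radius of [eP w]; a [v] in [CP H] would be within 2 of it,
     and the radius [s.+2] is at least 2. *)
  rewrite inE in_setU negb_or; apply/andP; split.
    by apply: contra nvw => vC; rewrite within_sym; apply: (centerP rad).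
  apply: contra nvw; rewrite CPE => /imsetP [u _ ->].
  exact: within_leq (within_embed eP_adj (w2 u)).
have [vN|nvN] := boolP (v \in outer_nbrs).
  pose far a := if a == v then w else default_far a.
  exists [set far a | a in outer_nbrs]; split.
  - apply: far_choice_no_common => a aN; rewrite /far.
    by case: eqP => [->|_]; [rewrite within_sym | apply: default_farP].
  - exact: far_set_le_inter.
  - by left; apply/imsetP; exists v; rewrite // /far eqxx.
(* Here [v] lies in [inter H] but outside [outer_nbrs], which makes the cardinality bound strict. *)
exists [set default_far a | a in outer_nbrs]; split.
- exact: far_choice_no_common default_farP.
- exact: far_set_le_inter.
- right; apply: leq_ltn_trans (leq_imset_card _ _) _.
  apply: proper_card; apply/properP; split; first exact: outer_nbrs_sub_inter.
  by exists v.
Qed.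

End FixRadius.
End LowerBound.

Section RealizableLowerBound.
Variables (n : nat) (P : sgraph) (k : nat).
Hypothesis n_ge2 : 2 <= n.
Hypothesis realizable_k : ucg_realizable (complete n) P k.

Lemma ucg_realizable_far_set :
  exists2 S : {set P}, no_common_closed_nbr S & #|S| <= k.
Proof.
have [H [ucg /induced_isoP [eZ [_ eZ_adj centerE]]]] := realizable_k.
move=> /induced_isoP [eP [_ eP_adj CPE]] <-.
have [s rad] := ucg_radius_ge2 n_ge2 ucg eZ_adj centerE.
exact (far_set_exists n_ge2 ucg centerE eP_adj CPE rad).
Qed.

Lemma ucg_realizable_far_set_through w : (forall u, within 2 u w) ->
  exists S : {set P}, [/\ no_common_closed_nbr S, #|S| <= k & w \in S \/ #|S| < k].
Proof.
have [H [ucg /induced_isoP [eZ [_ eZ_adj centerE]]]] := realizable_k.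
move=> /induced_isoP [eP [_ eP_adj CPE]] <-.
have [s rad] := ucg_radius_ge2 n_ge2 ucg eZ_adj centerE.
exact (far_set_exists_through n_ge2 ucg centerE eP_adj CPE rad (w := w)).
Qed.

End RealizableLowerBound.

(** * Sizes of sets without a common closed neighbour *)

Lemma no_common_closed_nbr_gt1 (P : sgraph) (S : {set P}) (p : P) :
  no_common_closed_nbr S -> 2 <= #|S|.
Proof.
move=> ncS; have [s sS _] := ncS p; have [s' s'S nss'] := ncS s.
by rewrite (cardD1 s) (cardD1 s') !inE sS s'S;
   case: eqP nss' => // ->; rewrite within_refl.
Qed.

(** The condition at [w] gives a second element [s]; the condition at a midpoint of [w] and [s]
    gives a third. *)
Lemma no_common_closed_nbr_through (P : sgraph) (S : {set P}) (w : P) :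
  no_common_closed_nbr S -> w \in S -> (forall u, within 2 u w) -> 3 <= #|S|.
Proof.
move=> ncS wS w2; have [s sS nsw] := ncS w.
have [q wq qs] : exists2 q, within 1 w q & within 1 q s.
  by apply: within2_midpoint; rewrite within_sym.
have [s' s'S ns'q] := ncS q.
have Nsw : s != w by apply: contraNneq nsw => ->; apply: within_refl.
have Ns'w : s' != w by apply: contraNneq ns'q => ->.
have Ns's : s' != s by apply: contraNneq ns'q => ->; rewrite within_sym.
by rewrite (cardD1 w) (cardD1 s) (cardD1 s') !inE wS sS s'S Nsw Ns'w Ns's.
Qed.

Lemma ucg_realizable_ge2 (n : nat) (P : sgraph) (k : nat) (p : P) :
  2 <= n -> ucg_realizable (complete n) P k -> 2 <= k.
Proof.
move=> n_ge2 /(ucg_realizable_far_set n_ge2) [S ncS].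
exact: leq_trans (no_common_closed_nbr_gt1 p ncS).
Qed.

Lemma ucg_realizable_ge3 (n : nat) (P : sgraph) (k : nat) (w : P) :
  2 <= n -> (forall u, within 2 u w) -> ucg_realizable (complete n) P k -> 3 <= k.
Proof.
move=> n_ge2 w2 rk.
have [S [ncS Sk [wS|]]] := ucg_realizable_far_set_through n_ge2 rk w2.
  exact: leq_trans (no_common_closed_nbr_through ncS wS w2) Sk.
exact: leq_ltn_trans (no_common_closed_nbr_gt1 w ncS).
Qed.

(** * Upper bound: the graph built from a map [f : P -> J] *)

Section Construction.
Variables (n : nat) (J : finType) (P : sgraph) (f : P -> J).

Definition hub_vertex : finType := (('I_n + J) + P)%type.

Definition hub_adj (u v : hub_vertex) : bool :=
  match u, v with
  | inl (inl i), inl (inl j) => i != j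
  | inl (inl _), inl (inr _) | inl (inr _), inl (inl _) => true
  | inl (inr j), inr p | inr p, inl (inr j) => f p == j
  | inr p, inr q => adj p q
  | _, _ => false
  end.

Fact hub_sym : symmetric hub_adj.
Proof.
by move=> [[i|j]|p] [[i'|j']|q] //=; [rewrite eq_sym | rewrite adj_sym].
Qed.

Fact hub_irr : irreflexive hub_adj.
Proof. by move=> [[i|j]|p] //=; rewrite ?eqxx ?adj_irr. Qed.

Definition hub : sgraph := SGraph hub_sym hub_irr.

Let hubZ (i : 'I_n) : hub := inl (inl i).
Let hubI (j : J) : hub := inl (inr j).
Let hubP (p : P) : hub := inr p.

(** As [J] is independent, this says exactly that [p] and [j] are at distance more than 2 in
    [hub]. *)
Definition avoids (j : J) (p : P) : Prop :=
  f p != j /\ forall q, adj p q -> f q != j.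

Hypothesis n_gt0 : 0 < n.
Variable p0 : P.
Hypothesis J_far : forall j, exists p, avoids j p.
Hypothesis P_far : forall p,
  (exists j, avoids j p) \/ (exists2 q, f p != f q & ~~ within 2 p q).

Lemma avoids_far j p : avoids j p -> ~~ within 2 (hubP p) (hubI j).
Proof.
move=> [/negPf fp nfp]; apply/negP => /within2P [//|/=|[]].
  by rewrite fp.
move=> [[i|j']|q] //= pq /eqP fq.
by have := nfp q pq; rewrite fq eqxx.
Qed.

Lemma hubZ_near i u : within 2 u (hubZ i).
Proof.
case: u => [[i'|j]|p].
- apply: (@within_leq _ 1) => //; rewrite within1E.
  change ((hubZ i' == hubZ i) || (i' != i)); rewrite -implyNb.
  by apply/implyP; apply: contraNneq => ->.
- by apply: (@within_leq _ 1) => //; apply: within_adj.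
- apply: (@within_cons _ _ _ (hubI (f p))); first by rewrite /= eqxx.
  exact: within_adj.
Qed.

Lemma hub_radius : radius hub = Fin 2.
Proof.
apply: radius_eqP => [|[[i|j]|p]].
- by exists (hubZ (Ordinal n_gt0)) => u; apply: hubZ_near.
- by exists (hubP p0); rewrite within1E.
- have [p /avoids_far h] := J_far j; exists (hubP p).
  by apply: contra h; apply: within_leq.
- have [[j /avoids_far h]|[q fpq npq]] := P_far p.
    by exists (hubI j); apply: contra h; rewrite within_sym; apply: within_leq.
  exists (hubP q); apply: contra npq; rewrite within1E.
  case/orP=> [/eqP [<-]|qp]; first exact: within_refl.
  by apply: (@within_leq _ 1) => //; apply: within_adj; rewrite adj_sym.
Qed.

(** [J_far] rules out the vertices of [J]. For [p] in [P], either [P_far] gives a far [j], or it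
    gives [q]: a walk of length at most 2 from [q] to [p] stays in [P] or passes through a common
    value of [f], and both are excluded. *)
Lemma hub_center : center hub = [set hubZ i | i : 'I_n].
Proof.
apply/setP => u; apply/idP/imsetP => [|[i _ ->]]; last first.
  by apply/(centerP hub_radius) => u'; apply: hubZ_near.
case: u => [[i|j]|p] uC; first by exists i.
- have [p /avoids_far /negP[]] := J_far j.
  exact: (centerP hub_radius _ uC).
- have [[j /avoids_far /negP[]]|[q fpq npq]] := P_far p.
    by rewrite within_sym; apply: (centerP hub_radius _ uC).
  have /within2P[[/esym pq]|/= qp|[[[i|j]|w] //= ]] :=
      centerP hub_radius _ uC (hubP q).
  + by case/negP: npq; rewrite pq within_refl.
  + by case/negP: npq; apply: within_cons (within_refl _ _); rewrite adj_sym.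
  + by move=> /eqP fq /eqP fp; rewrite fq fp eqxx in fpq.
  + move=> qw wp; case/negP: npq; apply: (@within_cons _ _ _ w).
      by rewrite adj_sym.
    by apply: within_adj; rewrite adj_sym.
Qed.

Lemma hub_EC i : EC (hubZ i) = [set hubP p | p : P].
Proof.
apply/setP => u; rewrite (in_EC hub_radius); last first.
  by rewrite hub_center imset_f.
rewrite within1E; case: u => [[i'|j]|p] /=.
- rewrite (_ : _ || _); last first.
    change ((hubZ i == hubZ i') || (i != i')); rewrite -implyNb.
    by apply/implyP; apply: contraNneq => ->.
  by symmetry; apply/imsetP => -[].
- by symmetry; apply/imsetP => -[].
- by symmetry; apply/imsetP; exists p.
Qed.

Lemma hub_UCG : is_UCG hub.
Proof.
by move=> c c'; rewrite hub_center => /imsetP [i _ ->] /imsetP [i' _ ->];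
   rewrite !hub_EC.
Qed.

Lemma hub_CP : CP hub = [set hubP p | p : P].
Proof.
have cC : hubZ (Ordinal n_gt0) \in center hub by rewrite hub_center imset_f.
apply/setP => u.
by rewrite (in_CP hub_radius _ hub_UCG cC) -(in_EC hub_radius _ cC) hub_EC.
Qed.

Lemma hub_inter : #|inter hub| = #|J|.
Proof.
have -> : inter hub = [set hubI j | j : J].
  apply/setP => u; rewrite in_setC in_setU hub_center hub_CP negb_or.
  apply/andP/imsetP => [[]|[j _ ->]]; last by split; apply/imsetP => -[].
  case: u => [[i|j]|p]; rewrite ?imset_f //; by exists j.
by apply: card_imset => j j' [].
Qed.

Lemma ucg_realizable_hub : ucg_realizable (complete n) P #|J|.
Proof.
exists hub; split; first exact: hub_UCG.
- by apply/induced_isoP; exists hubZ; split=> [i j []||]; rewrite ?hub_center.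
- by apply/induced_isoP; exists hubP; split=> [p q []||]; rewrite ?hub_CP.
- exact: hub_inter.
Qed.

End Construction.

(** * Two-colourings in which every vertex has a neighbour of the other colour *)

Section TwoColouring.
Variables (T : finType) (F : rel T).
Hypothesis F_sym : symmetric F.
Hypothesis F_irr : irreflexive F.
Hypothesis F_noisolated : forall v, exists w, F v w.

Definition mutual_nbrs (A B : {set T}) : Prop :=
  (forall v, v \in A -> exists2 w, w \in B & F v w) /\
  (forall v, v \in B -> exists2 w, w \in A & F v w).

Lemma mutual_nbrsC A B : mutual_nbrs A B -> mutual_nbrs B A.
Proof. by case. Qed.

Lemma mutual_nbrs_add A B v w : mutual_nbrs A B -> F v w ->
  mutual_nbrs (v |: A) (w |: B).
Proof.
move=> [hA hB] vw; split=> x /setU1P [->|].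
- by exists w; rewrite ?setU11.
- by case/hA => y yB xy; exists y; rewrite // setU1r.
- by exists v; rewrite ?setU11 // F_sym.
- by case/hB => y yB xy; exists y; rewrite // setU1r.
Qed.

(** Induction on the number of uncoloured vertices: an uncoloured [v] is coloured oppositely to some
    neighbour [w], which is coloured along with it if necessary. *)
Lemma two_colouring_extend (A B : {set T}) :
  {in A, forall x, x \notin B} -> mutual_nbrs A B ->
  exists f : T -> bool,
    [/\ {in A, forall v, f v}, {in B, forall v, ~~ f v}
      & forall v, exists2 w, f v != f w & F v w].
Proof.
have [k] := ubnP #|~: (A :|: B)|; elim: k A B => // k IH A B.
rewrite ltnS => ltk dAB mAB.
have [v|all_AB] := pickP (mem (~: (A :|: B))); last first.
  have AorB v : (v \in A) || (v \in B).
    by have := all_AB v; rewrite inE inE inE => /negbT; rewrite negbK.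
  have nAB v : v \in B -> v \notin A.
    by apply: contraL => /dAB.
  exists (mem A); split=> // v; case/orP: (AorB v) => hv.
    have [w wB vw] := mAB.1 v hv; exists w => //=.
    by rewrite hv (negPf (nAB w wB)).
  have [w wA vw] := mAB.2 v hv; exists w => //=.
  by rewrite wA (negPf (nAB v hv)).
rewrite /= in_setC in_setU negb_or => /andP [nvA nvB].
have card_lt (A' B' : {set T}) : A \subset A' -> B \subset B' -> v \in A' :|: B' ->
    #|~: (A' :|: B')| < k.
  move=> sA sB vAB; apply: leq_trans ltk; apply: proper_card; apply/properP.
  split; first by rewrite setCS setUSS.
  exists v; first by rewrite in_setC in_setU negb_or nvA.
  by rewrite in_setC vAB.
have [w vw] := F_noisolated v.
have Nvw : v != w by apply: contraTneq vw => ->; rewrite F_irr.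
have [wA|nwA] := boolP (w \in A).
  have mAB' := mutual_nbrsC (mutual_nbrs_add (mutual_nbrsC mAB) vw).
  have wE : w |: A = A by apply/setUidPr; rewrite sub1set.
  rewrite wE in mAB'.
  have [||f [fA fB fF]] := IH A (v |: B) _ _ mAB'.
  - by apply: card_lt; rewrite ?subsetUr // !inE eqxx orbT.
  - move=> x xA; rewrite in_setU1 negb_or dAB // andbT.
    by apply: contraTneq xA => ->.
  exists f; split=> // x xB; apply: fB; exact: setU1r.
(* Now [w] is in [B] or uncoloured; either way [v] can join [A] and [w] join [B]. *)
have mAB' := mutual_nbrs_add mAB vw.
have [||f [fA fB fF]] := IH _ _ _ _ mAB'.
- by apply: card_lt; rewrite ?subsetUr // !inE eqxx.
- move=> x; rewrite !in_setU1 negb_or => /orP [/eqP ->|xA].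
    by rewrite Nvw.
  by rewrite dAB // andbT; apply: contraTneq xA => ->.
exists f; split=> // x xAB; [apply: fA | apply: fB]; exact: setU1r.
Qed.

End TwoColouring.

(** * Realizations with two and three intermediate vertices *)

Lemma ucg_realizable2 (n : nat) (P : sgraph) : 0 < n ->
  (Fin 3 < diam P)%O -> (Fin 2 < radius P)%O -> ucg_realizable (complete n) P 2.
Proof.
move=> n_gt0 /diam_gtP [x [y nxy]] rad.
pose F (u v : P) := ~~ within 2 u v.
have F_sym : symmetric F by move=> u v; rewrite /F within_sym.
have F_irr : irreflexive F by move=> u; rewrite /F within_refl.
have F_noisolated v : exists w, F v w.
  by have [w nwv] := radius_gt_ecc v rad; exists w; rewrite F_sym.
(* As [x] and [y] are more than 3 apart, these balls are disjoint, and each vertex of one is at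
   distance at least 3 from the center of the other. Colours constant on them make [x] avoid [true]
   and [y] avoid [false]. *)
pose A := [set v | within 1 y v]; pose B := [set v | within 1 x v].
have nAB : {in A, forall v, v \notin B}.
  move=> v; rewrite !inE => yv; apply: contra nxy => xv.
  apply: (@within_leq _ 2) => //; apply: (within_trans xv).
  by rewrite within_sym.
have mAB : mutual_nbrs F A B.
  split=> v; rewrite inE => hv.
    exists x; first by rewrite inE within_refl.
    apply: contra nxy => vx; rewrite within_sym.
    exact: within_trans hv vx.
  exists y; first by rewrite inE within_refl.
  by apply: contra nxy => vy; apply: within_trans hv vy.
have [f [fA fB fF]] :=
  two_colouring_extend F_sym F_irr F_noisolated nAB mAB.
rewrite -card_bool; apply: (@ucg_realizable_hub _ _ _ f) => //.
- case.
    exists x; split=> [|q xq]; first by rewrite (negPf (fB _ _)) // inE within_refl.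
    by rewrite (negPf (fB _ _)) // inE within_adj.
  exists y; split=> [|q yq]; first by rewrite fA // inE within_refl.
  by rewrite fA // inE within_adj.
- by move=> p; right; apply: fF.
Qed.

Lemma ucg_realizable3 (n : nat) (P : sgraph) : 0 < n ->
  (Fin 2 < diam P)%O -> ucg_realizable (complete n) P 3.
Proof.
move=> n_gt0 /diam_gtP [x [y nxy]].
have -> : 3 = #|{: option bool}| by rewrite card_option card_bool.
have None_avoided p : avoids (fun p => Some (within 1 x p)) None p by [].
apply: (@ucg_realizable_hub _ _ _ (fun p => Some (within 1 x p))) => //.
- case=> [[]|]; last by exists x.
    exists y; split=> [|q yq].
      by apply: contra nxy => /eqP [xy]; apply: (@within_leq _ 1).
    apply: contra nxy => /eqP [xq].
    by apply: (@within_trans _ 1 1 _ q) => //; apply: within_adj; rewrite adj_sym.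
  exists x; split=> [|q xq]; first by rewrite within_refl.
  by rewrite within_adj.
- by move=> p; left; exists None.
Qed.

(** * Cocktail party graphs and unbounded [A_ucg] *)

Section CocktailParty.
Variable m : nat.

Definition cocktail_adj : rel ('I_m * bool) := fun u v => u.1 != v.1.

Fact cocktail_sym : symmetric cocktail_adj.
Proof. by move=> u v; rewrite /cocktail_adj eq_sym. Qed.

Fact cocktail_irr : irreflexive cocktail_adj.
Proof. by move=> u; rewrite /cocktail_adj eqxx. Qed.

Definition cocktail_party : sgraph := SGraph cocktail_sym cocktail_irr.

Lemma cocktail_within1 (u v : cocktail_party) :
  within 1 u v = (v != (u.1, ~~ u.2)).
Proof.
rewrite within1E; case: u v => [i a] [j b] /=.
rewrite /cocktail_adj !xpair_eqE /= eq_sym.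
by case: eqP => //=; case: a b => [] [].
Qed.

(** Only [(i, a)] has [(i, ~~ a)] outside its closed neighbourhood, so every [(i, a)] must belong to
    [S]. *)
Lemma cocktail_no_common (S : {set cocktail_party}) :
  no_common_closed_nbr S -> m <= #|S|.
Proof.
move=> ncS; have -> : S = setT.
  apply/setP => -[i a]; rewrite inE.
  have [[j b] sS] := ncS (i, ~~ a).
  rewrite cocktail_within1 negbK /= => /eqP [-> /negb_inj ->].
  by [].
by rewrite cardsT card_prod card_ord card_bool leq_pmulr.
Qed.

Hypothesis m_gt1 : 1 < m.

Lemma cocktail_within2 (u v : cocktail_party) : within 2 u v.
Proof.
(* Any vertex of another part is a common neighbour of [u] and its antipode. *)
have [k ku] : exists k : 'I_m, k != u.1.
  pose k0 : 'I_m := Ordinal (ltnW m_gt1); pose k1 : 'I_m := Ordinal m_gt1.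
  by case: (eqVneq k0 u.1) => [<-|]; [exists k1 | exists k0].
have [uv|uv] := eqVneq u.1 v.1; last first.
  by apply: (@within_leq _ 1) => //; apply: within_adj.
apply: (@within_cons _ _ _ ((k, true) : cocktail_party)).
  by rewrite /= /cocktail_adj eq_sym.
by apply: within_adj; rewrite /= /cocktail_adj -uv.
Qed.

Lemma cocktail_radius : radius cocktail_party = Fin 2.
Proof.
apply: radius_eqP => [|v].
  by exists ((Ordinal m_gt1, true) : cocktail_party) => u; apply: cocktail_within2.
by exists ((v.1, ~~ v.2) : cocktail_party); rewrite within_sym cocktail_within1 eqxx.
Qed.

Lemma cocktail_diam : diam cocktail_party = Fin 2.
Proof.
apply/eqP; rewrite eq_le; apply/andP; split.
  by apply/diam_leP; apply: cocktail_within2.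
rewrite -cocktail_radius.
apply: le_trans (radius_le_ecc ((Ordinal m_gt1, true) : cocktail_party)) _.
exact: le_bigmax.
Qed.

End CocktailParty.

Theorem theorem6p2 (n : nat) (hn : 2 <= n) :
  (forall P : sgraph,
     ((Fin 4 <= diam P)%O -> (Fin 3 <= radius P)%O ->
        A_ucg (complete n) P = Fin 2) /\
     ((Fin 3 <= diam P)%O -> radius P = Fin 2 ->
        A_ucg (complete n) P = Fin 3)) /\
  (forall t : nat, exists P : sgraph,
     [/\ diam P = Fin 2, radius P = Fin 2 &
         (Fin t <= A_ucg (complete n) P)%O]).
Proof.
have n_gt0 := ltnW hn; split=> [P|t].
  rewrite -!Fin_ltE; split=> [dP rP|dP rP]; apply: A_ucg_eq.
  - exact: ucg_realizable2.
  - by have [p _] := diam_gtP dP => k; apply: ucg_realizable_ge2.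
  - exact: ucg_realizable3.
  - have /radius_leP [w w2] : (radius P <= Fin 2)%O by rewrite rP.
    by move=> k; apply: ucg_realizable_ge3 w2.
(* The shift by 2 secures [1 < m] for every [t]. *)
exists (cocktail_party t.+2); split.
- exact: cocktail_diam.
- exact: cocktail_radius.
apply: A_ucg_ge => k /(ucg_realizable_far_set hn) [S /cocktail_no_common].
by move=> lt_tS leSk; apply: leq_trans (leq_trans lt_tS leSk); rewrite ltnW.
Qed.
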